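(* Let $E$ be a $3$-dimensional real vector space equipped with an inner product and let $\mathbb{S}^2$ be its unit sphere. There is a homotopy of immersions of $\mathbb{S}^2$ into $E$ from the inclusion map to the antipodal map $q\mapsto -q$. That is, there is a smooth map $f:\mathbb{R}\times E\to E$, $(t,x)\mapsto f_t(x)$, such that $f_0(x)=x$ and $f_1(x)=-x$ for all $x\in\mathbb{S}^2$, and such that for every $t\in[0,1]$ the map $f_t$ is an immersion of $\mathbb{S}^2$ into $E$.
   Context: Smooth means infinitely differentiable. For $x\in\mathbb{S}^2$, the tangent space $T_x\mathbb{S}^2$ is the subspace $x^\perp$ of $E$ orthogonal to the line spanned by $x$. An immersion of $\mathbb{S}^2$ into $E$ is a smooth map $f$, with values in $E$, defined on a neighbourhood of $\mathbb{S}^2$ in $E$, such that for every $x\in\mathbb{S}^2$ the derivative $Df(x)$ is injective on $T_x\mathbb{S}^2=x^\perp$. *)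

(* Defs.v *)
From HB Require Import structures.
From mathcomp Require Import all_boot all_order all_algebra.
From mathcomp Require Import all_classical all_reals all_analysis.

Set Implicit Arguments.
Unset Strict Implicit.
Unset Printing Implicit Defensive.
Import Order.TTheory GRing.Theory Num.Theory.
Import numFieldNormedType.Exports.

Local Open Scope classical_set_scope.
Local Open Scope ring_scope.

#[short(type="normedVectType")]
HB.structure Definition NormedVector (R : numDomainType) :=
  {E of NormedModule R E & Vector R E}.

(* The norm of a normedVectType is unrelated to any form on it; this says that
   it is the Euclidean norm of the inner product dot. *)
Definition induces_norm (R : realType) (E : normedModType R)
    (dot : {dot E for idfun}) : Prop :=
  forall x : E, `|x| = Num.sqrt (dot x x).

(* C^n regularity on an open set U. The differential is passed on to the next
   order through its values x |-> 'd f x v, rather than as a map into a normed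
   space of linear maps; for finite-dimensional V this is the usual notion. *)
Fixpoint Cn_on (R : realType) (V W : normedModType R) (n : nat)
    (U : set V) (f : V -> W) : Prop :=
  match n with
  | 0 => forall x, U x -> {for x, continuous f}
  | n'.+1 => (forall x, U x -> differentiable f x) /\
             (forall v, Cn_on n' U (fun x => 'd f x v))
  end.

Definition smooth_on (R : realType) (V W : normedModType R)
    (U : set V) (f : V -> W) : Prop :=
  forall n, Cn_on n U f.

Definition unit_sphere (R : realType) (E : normedModType R) : set E :=
  [set x | `|x| = 1].
Arguments unit_sphere {R} E.

Definition tangent_space (R : realType) (E : normedModType R)
    (dot : {dot E for idfun}) (x : E) : set E :=
  [set v | dot x v = 0].

(* Only the restriction of f to some open neighbourhood of the sphere matters:
   f is total as a Rocq function, but nothing is required of it elsewhere. *)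
Definition sphere_immersion (R : realType) (E : normedModType R)
    (dot : {dot E for idfun}) (f : E -> E) : Prop :=
  (exists U : set E, [/\ open U, unit_sphere E `<=` U & smooth_on U f]) /\
  (forall x, unit_sphere E x ->
     {in tangent_space dot x &, injective ('d f x)}).

(* Main.v *)
(* The eversion is a variant of the ruled-surface eversion of A. and W. Bednorz.
   For real p, t consider the map of the cylinder, with coordinates h and phi,
     w = x + i y = (t + i h) e^(i phi) + i p e^(- i phi),
     z = p (h sin 2 phi - (t / 2) cos 2 phi).
   The differential of w is degenerate exactly where h = p cos 2 phi, and along
   its kernel z has derivative p^2 (2 - sin^2 2 phi). Substituting
   h = Z / (X^2 + Y^2), with phi the longitude, the map
     exp (z / (1/8 + |w|^2) - t Z / 2)
       (w (1/8 + |w|^2)^(-3/4), (1/8 - |w|^2) / (1/8 + |w|^2))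
   extends smoothly to the poles. The direction of the vector depends only on w,
   immersively, and its length varies with z. The term - t Z / 2 turns
   p^2 (2 - sin^2 2 phi) into a positive definite quadratic form in (p, t), so the
   map is an immersion whenever |p|, |t| <= 1 and (p, t) <> (0, 0). For p = 0 it
   is, up to a twist, a surface of revolution, and if moreover |t| >= 1/2, the
   linear homotopy to the inclusion (t > 0) or to the antipodal map (t < 0)
   consists of immersions. So t runs from 1 to -1, with p > 0 exactly where
   |t| < 1/2 and the linear homotopies carried out where |t| >= 1/2. *)
Require Import Defs.
From mathcomp Require Import all_boot all_order all_algebra.
From mathcomp Require Import all_classical all_reals all_analysis.
From mathcomp Require Import ring lra.

Set Implicit Arguments.
Unset Strict Implicit.
Unset Printing Implicit Defensive.
Import Order.TTheory GRing.Theory Num.Theory.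
Import numFieldNormedType.Exports.
Local Open Scope classical_set_scope.
Local Open Scope ring_scope.

(** * Smooth functions *)

Section SmoothFunctions.
Context {R : realType} {V : normedModType R}.

Lemma eq_Cn_on (W : normedModType R) n U (g f : V -> W) :
  f =1 g -> Cn_on n U g -> Cn_on n U f.
Proof. by move=> /funext ->. Qed.

Lemma eq_smooth_on (W : normedModType R) U (g f : V -> W) :
  f =1 g -> smooth_on U g -> smooth_on U f.
Proof. by move=> /funext ->. Qed.

(** The Leibniz and chain rules leave undifferentiated factors in the derivative. The induction
    hypothesis reaches them only after their order has been lowered by one. *)
Lemma Cn_on_pred (W : normedModType R) n (f : V -> W) : Cn_on n.+1 setT f -> Cn_on n setT f.
Proof.
elim: n f => [|n IH] f [df dfv]; first by move=> x _; exact/differentiable_continuous/df.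
by split=> // v; exact/IH/dfv.
Qed.

Lemma Cn_on_cst (W : normedModType R) n (w : W) : Cn_on n setT (fun _ : V => w).
Proof.
elim: n w => [|n IH] w; first by move=> x _; exact: cst_continuous.
split=> [x _|v]; first exact: differentiable_cst.
apply: (@eq_Cn_on _ _ _ (fun=> 0)) => // x.
by rewrite (_ : (fun=> w) = cst w)// diff_cst.
Qed.

Lemma Cn_onD (W : normedModType R) n (f g : V -> W) :
  Cn_on n setT f -> Cn_on n setT g -> Cn_on n setT (fun x => f x + g x).
Proof.
elim: n f g => [|n IH] f g; first by move=> cf cg x _; apply: continuousD; [exact: cf|exact: cg].
move=> [df dfv] [dg dgv]; split=> [x _|v].
  by apply: differentiableD; [exact: df|exact: dg].
apply: (@eq_Cn_on _ _ _ (fun x => 'd f x v + 'd g x v)); last by apply: IH; [exact: dfv|exact: dgv].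
by move=> x; rewrite diffD//; [exact: df|exact: dg].
Qed.

Lemma Cn_onM n (f g : V -> R) :
  Cn_on n setT f -> Cn_on n setT g -> Cn_on n setT (fun x => f x * g x).
Proof.
elim: n f g => [|n IH] f g.
  by move=> cf cg x _; apply: continuousM; [exact: cf|exact: cg].
move=> cf cg; have [df dfv] := cf; have [dg dgv] := cg; split=> [x _|v].
  by apply: differentiableM; [exact: df|exact: dg].
apply: (@eq_Cn_on _ _ _ (fun x => f x * 'd g x v + g x * 'd f x v)); last first.
  by apply: Cn_onD; apply: IH; [exact: Cn_on_pred|exact: dgv|exact: Cn_on_pred|exact: dfv].
by move=> x; rewrite diffM//; [exact: df|exact: dg].
Qed.

Lemma Cn_onZl (W : normedModType R) n (f : V -> R) (w : W) :
  Cn_on n setT f -> Cn_on n setT (fun x => f x *: w).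
Proof.
elim: n f => [|n IH] f.
  by move=> cf x _; apply: continuousZl; exact: cf.
move=> [df dfv]; split=> [x _|v]; first exact/differentiableZl/df.
apply: (@eq_Cn_on _ _ _ (fun x => 'd f x v *: w)); last exact/IH/dfv.
by move=> x; rewrite diffZl//; exact: df.
Qed.

(** The derivative of g o f contains g' o f, so the induction on n runs over a whole class [P] of
    outer functions, closed under derivation on a set [O] that contains the values of f. *)
Lemma Cn_on_comp (P : (R -> R) -> Prop) (O : set R) :
  (forall g, P g -> exists2 g', P g' & forall y, O y -> is_derive y 1 g (g' y)) ->
  forall n g (f : V -> R), P g -> (forall x, O (f x)) ->
  Cn_on n setT f -> Cn_on n setT (fun x => g (f x)).
Proof.
move=> HP; elim=> [|n IH] g f Pg Of.
  move=> cf x _; have [g' _ dg] := HP _ Pg; have ? := dg _ (Of x).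
  apply: (@continuous_comp _ _ _ f g); first exact: cf.
  by apply: differentiable_continuous; apply/derivable1_diffP; exact: ex_derive.
move=> cf; have [df dfv] := cf; have [g' Pg' dg] := HP _ Pg.
have Dg x : differentiable g (f x).
  by apply/derivable1_diffP; have [] := dg _ (Of x).
split=> [x _|v]; first by apply: differentiable_comp; [exact: df|exact: Dg].
apply: (@eq_Cn_on _ _ _ (fun x => 'd f x v * g' (f x))); last first.
  by apply: Cn_onM; [exact: dfv|apply: IH => //; exact: Cn_on_pred].
move=> x; rewrite (_ : (fun x => g (f x)) = g \o f)// diff_comp//; last exact: df.
rewrite /= deriv1E; last exact/derivable1_diffP/Dg.
by have ? := dg _ (Of x); rewrite derive1E derive_val.
Qed.

Lemma Cn_on_linear (W : normedModType R) n (f : {linear V -> W}) :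
  continuous f -> Cn_on n setT f.
Proof.
move=> cf; case: n => [|n]; first by move=> x _; exact: cf.
split=> [x _|v]; first exact: linear_differentiable.
apply: (@eq_Cn_on _ _ _ (fun=> f v)); last exact: Cn_on_cst.
by move=> x; rewrite diff_lin.
Qed.

Lemma smooth_cst (W : normedModType R) (w : W) : smooth_on setT (fun _ : V => w).
Proof. by move=> n; exact: Cn_on_cst. Qed.

Lemma smoothD (W : normedModType R) (f g : V -> W) :
  smooth_on setT f -> smooth_on setT g -> smooth_on setT (fun x => f x + g x).
Proof. by move=> cf cg n; apply: Cn_onD. Qed.

Lemma smoothM (f g : V -> R) :
  smooth_on setT f -> smooth_on setT g -> smooth_on setT (fun x => f x * g x).
Proof. by move=> cf cg n; apply: Cn_onM. Qed.

Lemma smoothZl (W : normedModType R) (f : V -> R) (w : W) :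
  smooth_on setT f -> smooth_on setT (fun x => f x *: w).
Proof. by move=> cf n; apply: Cn_onZl. Qed.

Lemma smoothN (f : V -> R) :
  smooth_on setT f -> smooth_on setT (fun x => - f x).
Proof.
move=> cf; apply: (@eq_smooth_on _ _ (fun x => -1 * f x)); last exact/smoothM/cf/smooth_cst.
by move=> x; rewrite mulN1r.
Qed.

Lemma smooth_powR (a : R) (f : V -> R) : (forall x, 0 < f x) ->
  smooth_on setT f -> smooth_on setT (fun x => f x `^ a).
Proof.
move=> f0 cf n.
(* The factor 1 puts the power into the class of functions c y^a, which is closed under derivation
   on y > 0. *)
apply: (@eq_Cn_on _ _ _ (fun x => 1 * f x `^ a)) => [x|]; first by rewrite mul1r.
apply: (@Cn_on_comp (fun g => exists c a, g = fun y => c * y `^ a) [set y | 0 < y] _ n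
  (fun y => 1 * y `^ a)) => //; last by exists 1, a.
move=> _ [c [b ->]]; exists (fun y => (c * b) * y `^ (b - 1)); first by exists (c * b), (b - 1).
move=> y /= y0; have h := is_derive1_powR b y0.
by apply: (is_derive_eq (is_deriveZ c h)); rewrite /GRing.scale/= mulrA.
Qed.

Lemma smooth_expR (f : V -> R) : smooth_on setT f -> smooth_on setT (fun x => expR (f x)).
Proof.
move=> cf n.
apply: (@Cn_on_comp (fun g => g = expR) setT) => // _ ->.
by exists expR => // y _; exact: is_derive_expR.
Qed.

End SmoothFunctions.

(** * Flat functions and the cutoff e^(-1/x) *)

Section FlatFunctions.
Context {R : realType}.

(** All derivatives of e^(-1/x) have this form, so the family over all polynomials q is closed under
    derivation. *)
Definition flat (q : {poly R}) (x : R) : R :=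
  if 0 < x then q.[x^-1] * expR (- x^-1) else 0.

(** Raise v <= 1 + v <= e^v, with v = u / (k+1), to the power k+1. One power more than k is taken in
    order to gain the factor 1/u. *)
Lemma expR_bound k (u : R) : 0 < u -> u ^+ k * expR (- u) <= k.+1%:R ^+ k.+1 / u.
Proof.
move=> u0; rewrite ler_pdivlMr// mulrAC -exprSr.
rewrite expRN ler_pdivrMr ?expR_gt0//.
rewrite -[in leRHS](@mulfVK _ k.+1%:R _ u) ?pnatr_eq0// expRM_natr -exprMn.
rewrite ler_pXn2r ?nnegrE ?(ltW u0) ?mulr_ge0 ?expR_ge0//.
have : u / k.+1%:R <= expR (u / k.+1%:R) by apply: le_trans (expR_ge1Dx _); rewrite lerDr.
by rewrite ler_pdivrMr// mulrC.
Qed.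

(** For h > 0, [expR_bound] with u = 1/h bounds the term of degree i by a multiple of h. *)
Lemma flat_lipschitz0 (q : {poly R}) : exists C, forall h, `|flat q h| <= C * `|h|.
Proof.
exists (\sum_(i < size q) `|q`_i| * i.+1%:R ^+ i.+1) => h.
have C0 : 0 <= \sum_(i < size q) `|q`_i| * i.+1%:R ^+ i.+1.
  by apply: sumr_ge0 => i _; rewrite mulr_ge0// exprn_ge0.
rewrite /flat; case: ifPn => h0; last by rewrite normr0 mulr_ge0.
rewrite horner_coef mulr_suml (gtr0_norm h0) mulr_suml.
apply: le_trans (ler_norm_sum _ _ _) _; apply: ler_sum => i _.
rewrite -!mulrA normrM ler_wpM2l// ger0_norm; last first.
  by rewrite mulr_ge0 ?expR_ge0// exprn_ge0// invr_ge0 ltW.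
by have := @expR_bound i h^-1; rewrite invrK invr_gt0; apply.
Qed.

Lemma is_derive_flat (q : {poly R}) (x : R) : is_derive x 1 (flat q) (flat ((q - q^`()) * 'X^2) x).
Proof.
have [x0|x0|->] := ltgtP x 0.
- rewrite {2}/flat ltNge (ltW x0)/=.
  apply: (@near_eq_is_derive _ _ _ (cst 0)) => //.
  near=> y; rewrite /flat ltNge (_ : y <= 0)//.
  by near: y; apply: (filterS _ (lt_nbhsl x0)) => ? /ltW.
- have xN := lt0r_neq0 x0.
  have dV : is_derive x 1 (fun y : R => y^-1) (- (x ^- 2)).
    apply: DeriveDef; first exact: derivableV.
    by rewrite deriveV// derive_id /GRing.scale/= mulr1.
  rewrite {2}/flat x0.
  have dN : is_derive x 1 (fun y : R => - y^-1) (x ^- 2).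
    by apply: is_derive_eq (is_deriveN dV) _; rewrite opprK.
  have dE := @is_derive1_comp R expR (fun y => - y^-1) x _ _ (is_derive_expR (- x^-1)) dN.
  have dq := @is_derive1_comp R (horner q) (fun y => y^-1) x _ _ (is_derive_poly q x^-1) dV.
  have dM := is_deriveM dq dE.
  apply: (@near_eq_is_derive _ R R (fun y : R => q.[y^-1] * expR (- y^-1))  (flat q) x 1).
    near=> y; rewrite /flat (_ : 0 < y)//.
    by near: y; exact: lt_nbhsr.
  apply: is_derive_eq dM _.
  rewrite /GRing.scale/= hornerM hornerXn hornerD hornerN exprVn.
  ring.
rewrite {2}/flat ltxx.
(* The difference quotient of [flat q] at 0 is [flat (q * 'X)], since dividing by h multiplies by
   the variable 1/h. The Lipschitz bound then sends it to 0. *)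
have [C HC] := flat_lipschitz0 (q * 'X).
have H : h^-1 *: (((flat q) \o shift 0) (h *: 1) - flat q 0) @[h --> 0^'] --> (0 : R).
  apply/cvgr0Pnorm_le => e e0; near=> h.
  have h0 : h != 0 by near: h; exact: nbhs_dnbhs_neq.
  have -> : h^-1 *: (((flat q) \o shift 0) (h *: 1) - flat q 0) = flat (q * 'X) h.
    rewrite /flat/= ltxx subr0 addr0 /GRing.scale/= mulr1.
    by case: ifP => _; rewrite ?mulr0// hornerMX mulrCA mulrA.
  apply: le_trans (HC h) _.
  have C1 : 0 < `|C| + 1 by rewrite ltr_wpDl.
  apply: (@le_trans _ _ ((`|C| + 1) * `|h|)).
    by rewrite ler_wpM2r// (le_trans (ler_norm _))// lerDl.
  rewrite mulrC -ler_pdivlMr//; near: h.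
  apply: dnbhs0_le; exact: divr_gt0.
by apply: DeriveDef; [apply/cvg_ex; exists 0|exact: cvg_lim H].
Unshelve. all: by end_near. Qed.

Implicit Types x y : R.

Lemma smooth_flat (V : normedModType R) (q : {poly R}) (f : V -> R) :
  smooth_on setT f -> smooth_on setT (fun v => flat q (f v)).
Proof.
move=> cf n.
apply: (@Cn_on_comp _ _ (fun g => exists q, g = flat q) setT _ n (flat q)) => //; last by exists q.
move=> _ [r ->]; exists (flat ((r - r^`()) * 'X^2)); first by exists ((r - r^`()) * 'X^2).
by move=> y _; exact: is_derive_flat.
Qed.

Definition cutoff x : R := flat 1 x.

Lemma cutoff_eq0 x : x <= 0 -> cutoff x = 0.
Proof. by rewrite /cutoff /flat leNgt => /negPf ->. Qed.

Lemma cutoffE x : 0 < x -> cutoff x = expR (- x^-1).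
Proof. by rewrite /cutoff /flat => ->; rewrite hornerC mul1r. Qed.

Lemma cutoff_gt0 x : 0 < x -> 0 < cutoff x.
Proof. by move=> /cutoffE ->; exact: expR_gt0. Qed.

Lemma cutoff_ge0 x : 0 <= cutoff x.
Proof. by have [/cutoff_eq0 ->//|/cutoff_gt0/ltW] := lerP x 0. Qed.

Lemma cutoff_le1 x : cutoff x <= 1.
Proof.
have [/cutoff_eq0 ->//|x0] := lerP x 0.
by rewrite cutoffE// -expR0 ler_expR oppr_le0 invr_ge0 ltW.
Qed.

Lemma cutoff_mono x y : x <= y -> cutoff x <= cutoff y.
Proof.
have [/cutoff_eq0 -> _|x0 xy] := lerP x 0; first exact: cutoff_ge0.
have y0 := lt_le_trans x0 xy.
by rewrite !cutoffE// ler_expR lerN2 lef_pV2.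
Qed.
End FlatFunctions.

(** * Algebra of the immersion condition *)

Section Algebra.
Context {R : realFieldType}.
Implicit Types (p t X Y Z a b c : R).

(* With h = Z / rsq and phi the longitude, hor1 + i hor2 = rsq^(3/2) w,
   hsq = rsq^2 |w|^2, hgt = rsq^2 z, den = rsq^2 (1/8 + |w|^2) and
   ver = rsq^2 (1/8 - |w|^2). *)
Definition rsq X Y : R := X * X + Y * Y.
Definition hor1 p t X Y Z : R := t * rsq X Y * X - Z * Y + p * rsq X Y * Y.
Definition hor2 p t X Y Z : R := t * rsq X Y * Y + Z * X + p * rsq X Y * X.
Definition hsq p t X Y Z : R :=
  Z * Z + (t * t + p * p) * (rsq X Y * rsq X Y)
  + 2 * p * Z * (X * X - Y * Y) + 4 * (p * t * rsq X Y * (X * Y)).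
Definition hgt p t X Y Z : R :=
  p * (2 * (Z * X * Y) - t / 2 * rsq X Y * (X * X - Y * Y)).
Definition den p t X Y Z : R := rsq X Y * rsq X Y / 8 + hsq p t X Y Z.
Definition ver p t X Y Z : R := rsq X Y * rsq X Y / 8 - hsq p t X Y Z.

(** Formal differentials, with p and t fixed, of the preceding polynomials along (dX, dY, dZ). They
    let the rank argument be pure algebra over any real field. *)
Definition drsq X Y dX dY : R := 2 * (X * dX + Y * dY).
Definition dhor1 p t X Y Z dX dY dZ : R :=
  t * (drsq X Y dX dY * X + rsq X Y * dX) - (dZ * Y + Z * dY)
  + p * (drsq X Y dX dY * Y + rsq X Y * dY).
Definition dhor2 p t X Y Z dX dY dZ : R :=
  t * (drsq X Y dX dY * Y + rsq X Y * dY) + (dZ * X + Z * dX)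
  + p * (drsq X Y dX dY * X + rsq X Y * dX).
Definition dhsq p t X Y Z dX dY dZ : R :=
  2 * Z * dZ + (t * t + p * p) * (2 * rsq X Y * drsq X Y dX dY)
  + 2 * p * (dZ * (X * X - Y * Y) + Z * (2 * X * dX - 2 * Y * dY))
  + 4 * (p * t * (drsq X Y dX dY * (X * Y) + rsq X Y * (dX * Y + X * dY))).
Definition dhgt p t X Y Z dX dY dZ : R :=
  p * (2 * (dZ * X * Y + Z * dX * Y + Z * X * dY)
       - t / 2 * (drsq X Y dX dY * (X * X - Y * Y)
                  + rsq X Y * (2 * X * dX - 2 * Y * dY))).
Definition dden p t X Y Z dX dY dZ : R :=
  rsq X Y * drsq X Y dX dY / 4 + dhsq p t X Y Z dX dY dZ.
Definition dver p t X Y Z dX dY dZ : R :=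
  rsq X Y * drsq X Y dX dY / 4 - dhsq p t X Y Z dX dY dZ.

Lemma hor_sq p t X Y Z :
  hor1 p t X Y Z * hor1 p t X Y Z + hor2 p t X Y Z * hor2 p t X Y Z
  = rsq X Y * hsq p t X Y Z.
Proof. by rewrite /hor1 /hor2 /hsq /rsq; ring. Qed.

(** By [hor_sq], the product with [rsq] is a sum of two squares. Where [rsq] vanishes, only Z^2
    remains. *)
Lemma hsq_ge0 p t X Y Z : 0 <= hsq p t X Y Z.
Proof.
have : 0 <= rsq X Y by rewrite /rsq; nra.
rewrite le_eqVlt => /orP[/eqP s0|s0].
  have X0 : X = 0 by move: s0; rewrite /rsq; nra.
  have Y0 : Y = 0 by move: s0; rewrite /rsq; nra.
  rewrite /hsq /rsq X0 Y0; nra.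
rewrite -(pmulr_rge0 _ s0) -hor_sq; nra.
Qed.

(* The last three hypotheses express that the differential of
   exp L (W1 D^(-3/4), W2 D^(-3/4), M / D) vanishes, where D = s^2/8 + B,
   M = s^2/8 - B, q = dD / D. The polar angle of this vector is a strictly
   monotone function of B / s^2, so the differential b / s^3 of B / s^2 vanishes. *)
Lemma polar_elimination (s ds B dB W1 W2 dW1 dW2 q dL : R) :
  0 < s -> 0 <= B ->
  W1 * W1 + W2 * W2 = s * B -> 2 * (W1 * dW1 + W2 * dW2) = ds * B + s * dB ->
  (s * s / 8 + B) * q = s * ds / 4 + dB ->
  dL * W1 + dW1 - 3 / 4 * W1 * q = 0 ->
  dL * W2 + dW2 - 3 / 4 * W2 * q = 0 ->
  dL * (s * s / 8 - B) + (s * ds / 4 - dB) - (s * s / 8 - B) * q = 0 ->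
  [/\ dL = 0, s * q = 2 * ds, 2 * s * dW1 = 3 * W1 * ds & 2 * s * dW2 = 3 * W2 * ds].
Proof.
move=> s0 B0 WW dWW Hq E1 E2 E3.
set D := s * s / 8 + B in Hq *.
set M := s * s / 8 - B in E3 *.
have D0 : 0 < D by rewrite /D; nra.
pose b := s * dB - 2 * B * ds.
have sq_ : s * D * q = b + 2 * D * ds by rewrite -mulrA Hq /b /D; field.
have H3 : dL * M * D = b * s / 4.
  apply: (mulfI (lt0r_neq0 s0)).
  have : s * D * (dL * M + (s * ds / 4 - dB) - M * q) = 0 by rewrite E3 mulr0.
  have -> : s * D * (dL * M + (s * ds / 4 - dB) - M * q) =
     dL * M * D * s + s * D * (s * ds / 4 - dB) - M * (s * D * q) by ring.
  rewrite sq_ => h; apply/eqP; rewrite -subr_eq0; apply/eqP; rewrite -h /b /D /M; by field.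
(* Weighting the two horizontal equations by W1 and W2 leaves only W1^2 + W2^2 = s B and its
   differential. *)
have HQ : dL * s * B * D = b * (B / 4 - s * s / 16).
  apply: (mulfI (lt0r_neq0 s0)).
  have : s * D * (W1 * (dL * W1 + dW1 - 3 / 4 * W1 * q) +
         W2 * (dL * W2 + dW2 - 3 / 4 * W2 * q)) = 0 by rewrite E1 E2 !mulr0 addr0 mulr0.
  have -> : s * D * (W1 * (dL * W1 + dW1 - 3 / 4 * W1 * q) +
         W2 * (dL * W2 + dW2 - 3 / 4 * W2 * q)) =
     s * D * (dL * (W1 * W1 + W2 * W2)  + (2 * (W1 * dW1 + W2 * dW2)) / 2)
     - 3 / 4 * (W1 * W1 + W2 * W2) * (s * D * q) by field.
  rewrite WW dWW sq_ => h; apply/eqP; rewrite -subr_eq0; apply/eqP; rewrite -h /b /D /M; by field.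
(* Eliminating dL between [H3] and [HQ] leaves b times 5 s^2 B / 32 + s^4 / 128 + B^2 / 4, which is
   positive. *)
have b0 : b = 0.
  have : b * (s * s * B / 4 - M * (B / 4 - s * s / 16)) = 0.
    have -> : b * (s * s * B / 4 - M * (B / 4 - s * s / 16)) =
      (b * s / 4) * (s * B) - M * (b * (B / 4 - s * s / 16)) by field.
    by rewrite -H3 -HQ; ring.
  move/eqP; rewrite mulf_eq0 => /orP[/eqP//|/eqP h].
  exfalso; move: h; rewrite /M; have : 0 < s * s by nra.
  by move: (s * s) => S S0 h; nra.
have dL0 : dL = 0.
  apply/eqP; apply/negPn/negP => dL0.
  have M0 : M = 0.
    move/eqP: H3; rewrite b0 !mul0r !mulf_eq0 (negPf dL0) (gt_eqF D0) orbF /=; exact/eqP.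
  have : B = 0.
    move/eqP: HQ; rewrite b0 !mul0r !mulf_eq0 (negPf dL0) (gt_eqF D0) (gt_eqF s0).
    by rewrite orbF /= => /eqP.
  by move: M0; rewrite /M; nra.
have sq2 : s * q = 2 * ds.
  by apply: (mulfI (lt0r_neq0 D0)); rewrite mulrCA mulrA sq_ b0; ring.
split => //.
  have : 2 * s * (dL * W1 + dW1 - 3 / 4 * W1 * q) = 0 by rewrite E1 mulr0.
  have -> : 2 * s * (dL * W1 + dW1 - 3 / 4 * W1 * q) =
   2 * s * dL * W1 + 2 * s * dW1 - 3 / 2 * W1 * (s * q) by field.
  rewrite sq2 dL0 => h; lra.
have : 2 * s * (dL * W2 + dW2 - 3 / 4 * W2 * q) = 0 by rewrite E2 mulr0.
have -> : 2 * s * (dL * W2 + dW2 - 3 / 4 * W2 * q) =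
 2 * s * dL * W2 + 2 * s * dW2 - 3 / 2 * W2 * (s * q) by field.
rewrite sq2 dL0 => h; lra.
Qed.

Lemma mulr_itv11 a b : -1 <= a <= 1 -> -1 <= b <= 1 -> -1 <= a * b <= 1.
Proof. by rewrite -!ler_norml normrM => a1 b1; rewrite mulr_ile1. Qed.

(** Z^2 and the t^2 term together contribute at most Z^2 + [rsq] = 1, the p^2 term at most 1, and
    each mixed term at most 2. Hence [den] <= 6 + 1/8, below the bound 7 of [form_gt0]. *)
Lemma hsq_le p t X Y Z : X * X + Y * Y + Z * Z = 1 -> -1 <= p <= 1 -> -1 <= t <= 1 ->
  hsq p t X Y Z <= 6.
Proof.
move=> XYZ p1 t1; rewrite /hsq.
have s0 : 0 <= rsq X Y <= 1 by rewrite /rsq; nra.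
have s1 : -1 <= rsq X Y <= 1 by lra.
have Z1 : -1 <= Z <= 1 by nra.
have [X0 Y0 Z0] : [/\ 0 <= X * X, 0 <= Y * Y & 0 <= Z * Z] by rewrite -!expr2 !sqr_ge0.
have d1 : -1 <= X * X - Y * Y <= 1 by lra.
have m1 : - 1 <= 2 * (X * Y) <= 1.
  have := sqr_ge0 (X - Y); have := sqr_ge0 (X + Y); rewrite !expr2 => ? ?.
  by apply/andP; split; lra.
have := mulr_itv11 p1 (mulr_itv11 Z1 d1).
have := mulr_itv11 (mulr_itv11 p1 t1) (mulr_itv11 s1 m1).
have := mulr_itv11 (mulr_itv11 p1 p1) (mulr_itv11 s1 s1).
have : t * t * (rsq X Y * rsq X Y) <= rsq X Y.
  have tt : 0 <= t * t <= 1 by nra.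
  have : rsq X Y * rsq X Y <= rsq X Y by nra.
  nra.
have : rsq X Y + Z * Z = 1 by rewrite /rsq; lra.
lra.
Qed.

(** Completing the square in t s leaves p^2 times a quantity that is at least 2 s^2 - m^2 - 7 m^2 /
    8 >= s^2 / 8. If p = 0, the square itself is positive. *)
Lemma form_gt0 p t s m G D : p != 0 \/ t != 0 -> 0 < s -> -s <= m <= s ->
  1 <= G -> 0 < D <= 7 ->
  0 < p * p * (2 * (s * s) - m * m) * G + D / 2 * ((t * s) * (t * s) - t * s * p * m).
Proof.
move=> pt s0 ms G1 D0.
have -> : p * p * (2 * (s * s) - m * m) * G + D / 2 * ((t * s) * (t * s) - t * s * p * m)
  = D / 2 * ((t * s - p * m / 2) * (t * s - p * m / 2))
    + p * p * ((2 * (s * s) - m * m) * G - D * (m * m) / 8) by field.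
have mm : m * m <= s * s by nra.
have ss : 0 < s * s by nra.
have c0 : 0 < (2 * (s * s) - m * m) * G - D * (m * m) / 8.
  have : (2 * (s * s) - m * m) * 1 <= (2 * (s * s) - m * m) * G.
    by rewrite ler_wpM2l//; nra.
  have : D * (m * m) <= 7 * (m * m) by rewrite ler_wpM2r//; nra.
  nra.
have [p0|p0] := eqVneq p 0.
  case: pt => [|t0]; first by rewrite p0 eqxx.
  rewrite p0 !mul0r subr0 addr0.
  have : 0 < (t * s) * (t * s) by rewrite -expr2 exprn_even_gt0//= mulf_neq0// gt_eqF.
  nra.
have pp : 0 < p * p by rewrite -expr2 exprn_even_gt0.
rewrite ltr_wpDl//; last exact: mulr_gt0.
rewrite mulr_ge0//; first lra.
by rewrite -expr2 sqr_ge0.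
Qed.

(** Off the poles, the rotation field (-Y, X, 0) and the meridian field (-X Z, -Y Z, rsq) span the
    tangent plane. *)
Lemma tangent_frame X Y Z dX dY dZ :
  X * X + Y * Y + Z * Z = 1 -> X * dX + Y * dY + Z * dZ = 0 -> 0 < rsq X Y ->
  exists u v, [/\ dX = - Y * u - X * Z * v, dY = X * u - Y * Z * v & dZ = rsq X Y * v].
Proof.
move=> S T s0; exists ((X * dY - Y * dX) / rsq X Y), (dZ / rsq X Y).
have T' : Z * dZ = - (X * dX + Y * dY) by lra.
have sN : X * X + Y * Y != 0 by exact: lt0r_neq0.
split; last by rewrite mulrCA divff ?mulr1// lt0r_neq0.
  rewrite -mulrA [Z * _]mulrA T' /rsq; by field.
rewrite -mulrA [Z * _]mulrA T' /rsq; by field.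
Qed.

(* Off the locus Z = p (X^2 - Y^2) the horizontal equations force u = 0; on it
   they determine v, and the last equation becomes a definite form in (p, t). *)
Lemma core_rank_off_poles p t X Y Z dX dY dZ D :
  -1 <= p <= 1 -> -1 <= t <= 1 -> p != 0 \/ t != 0 ->
  X * X + Y * Y + Z * Z = 1 -> X * dX + Y * dY + Z * dZ = 0 -> 0 < rsq X Y ->
  0 < D <= 7 ->
  2 * rsq X Y * dhor1 p t X Y Z dX dY dZ = 3 * hor1 p t X Y Z * drsq X Y dX dY ->
  2 * rsq X Y * dhor2 p t X Y Z dX dY dZ = 3 * hor2 p t X Y Z * drsq X Y dX dY ->
  rsq X Y * dhgt p t X Y Z dX dY dZ - 2 * hgt p t X Y Z * drsq X Y dX dY =
    t / 2 * rsq X Y * D * dZ ->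
  [/\ dX = 0, dY = 0 & dZ = 0].
Proof.
move=> p1 t1 pt S T s0 D0 E1 E2 E3.
have [u [v [dXE dYE dZE]]] := tangent_frame S T s0.
have sN : rsq X Y != 0 by exact: lt0r_neq0.
have ssN : 2 * rsq X Y * rsq X Y != 0 by rewrite !mulf_neq0 ?pnatr_eq0.
(* The component of the horizontal equations along (X, Y) loses v. The component along (-Y, X),
   taken in [F2], expresses v through u. *)
have F1 : (p * (X * X - Y * Y) - Z) * u = 0.
  apply: (mulfI ssN); rewrite mulr0.
  transitivity (X * (2 * rsq X Y * dhor1 p t X Y Z dX dY dZ - 3 * hor1 p t X Y Z * drsq X Y dX dY)
    + Y * (2 * rsq X Y * dhor2 p t X Y Z dX dY dZ - 3 * hor2 p t X Y Z * drsq X Y dX dY)).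
    by rewrite dXE dYE dZE /dhor1 /dhor2 /hor1 /hor2 /drsq /rsq; ring.
  by rewrite E1 E2 !subrr !mulr0 addr0.
have F2 : (rsq X Y + 2 * (Z * Z)) * v + (t * rsq X Y - 2 * p * X * Y) * u = 0.
  apply: (mulfI ssN); rewrite mulr0.
  transitivity (X * (2 * rsq X Y * dhor2 p t X Y Z dX dY dZ - 3 * hor2 p t X Y Z * drsq X Y dX dY)
    - Y * (2 * rsq X Y * dhor1 p t X Y Z dX dY dZ - 3 * hor1 p t X Y Z * drsq X Y dX dY)).
    by rewrite dXE dYE dZE /dhor1 /dhor2 /hor1 /hor2 /drsq /rsq; ring.
  by rewrite E1 E2 !subrr !mulr0 subr0.
have G1 : 1 <= rsq X Y + 2 * (Z * Z) by rewrite /rsq; nra.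
have uv : u = 0 -> v = 0.
  move=> u0; move: F2; rewrite u0 mulr0 addr0 => /eqP; rewrite mulf_eq0 => /orP[/eqP|/eqP//].
  by move=> h; move: G1; rewrite h ler10.
suff u0 : u = 0 by rewrite dXE dYE dZE u0 uv// !mulr0 !subr0.
apply/eqP/negPn/negP => u0.
have Zp : Z = p * (X * X - Y * Y).
  by move/eqP: F1; rewrite mulf_eq0 (negPf u0) orbF subr_eq0 => /eqP.
have F3 : rsq X Y * dhgt p t X Y Z dX dY dZ - 2 * hgt p t X Y Z * drsq X Y dX dY
  = p * rsq X Y * (2 * X * Y * ((rsq X Y + 2 * (Z * Z)) * v) + 2 * Z * (X * X - Y * Y) * u
      + 2 * t * X * Y * rsq X Y * u).
  by rewrite dXE dYE dZE /dhgt /hgt /drsq /rsq; field.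
(* The last equation is multiplied by G = rsq + 2 Z^2, so that [F2] eliminates v. With Z from [Zp],
   what remains is the form of [form_gt0] with m = 2 X Y, times rsq u. *)
have /eqP : (p * p * (2 * (rsq X Y * rsq X Y) - (2 * X * Y) * (2 * X * Y)) * (rsq X Y + 2 * (Z * Z))
   + D / 2 * ((t * rsq X Y) * (t * rsq X Y) - t * rsq X Y * p * (2 * X * Y))) * (rsq X Y * u) = 0.
  have Gv : (rsq X Y + 2 * (Z * Z)) * v = - ((t * rsq X Y - 2 * p * X * Y) * u) by lra.
  have : (rsq X Y + 2 * (Z * Z)) * (rsq X Y * dhgt p t X Y Z dX dY dZ
      - 2 * hgt p t X Y Z * drsq X Y dX dY) -
    t / 2 * rsq X Y * D * rsq X Y * ((rsq X Y + 2 * (Z * Z)) * v) = 0.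
    by rewrite E3 dZE; ring.
  rewrite F3 Gv => <-.
  move: (rsq X Y + 2 * (Z * Z)) => G; rewrite Zp /rsq; by field.
rewrite !mulf_eq0 (negPf u0) (negPf sN) !orbF gt_eqF// form_gt0//.
have := sqr_ge0 (X - Y); have := sqr_ge0 (X + Y); rewrite /rsq !expr2 => ? ?.
by apply/andP; split; lra.
Qed.

Lemma rsq_ge0 X Y : 0 <= rsq X Y.
Proof. by rewrite /rsq -!expr2 addr_ge0// sqr_ge0. Qed.

Lemma rsq_eq0 X Y : rsq X Y = 0 -> X = 0 /\ Y = 0.
Proof.
move/eqP; rewrite /rsq -!expr2 paddr_eq0 ?sqr_ge0// !sqrf_eq0.
by move=> /andP[/eqP -> /eqP ->].
Qed.

Lemma pole_tangent X Y Z dX dY dZ : X * X + Y * Y + Z * Z = 1 ->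
  X * dX + Y * dY + Z * dZ = 0 -> rsq X Y = 0 ->
  [/\ X = 0, Y = 0, Z * Z = 1 & dZ = 0].
Proof.
move=> S T /rsq_eq0[X0 Y0]; move: S T; rewrite X0 Y0 !mul0r !add0r => S T.
by split => //; rewrite -[dZ]mul1r -S -mulrA T mulr0.
Qed.

Lemma den_gt0 p t X Y Z : X * X + Y * Y + Z * Z = 1 -> 0 < den p t X Y Z.
Proof.
move=> S; have := rsq_ge0 X Y; rewrite le_eqVlt => /orP[/eqP/esym/rsq_eq0[X0 Y0]|s0].
  by move: S; rewrite /den /hsq /rsq X0 Y0 => S; lra.
have := hsq_ge0 p t X Y Z; rewrite /den; nra.
Qed.

(** Here q is the logarithmic differential of [den], and dL is the differential of the log-length
    hgt / den - t Z / 2. The poles are separate because [polar_elimination] needs [rsq] > 0; there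
    the horizontal part reduces to (-Z dY, Z dX). *)
Lemma core_rank p t X Y Z dX dY dZ q dL :
  -1 <= p <= 1 -> -1 <= t <= 1 -> p != 0 \/ t != 0 ->
  X * X + Y * Y + Z * Z = 1 -> X * dX + Y * dY + Z * dZ = 0 ->
  den p t X Y Z * q = dden p t X Y Z dX dY dZ ->
  den p t X Y Z * dL = dhgt p t X Y Z dX dY dZ - hgt p t X Y Z * q
    - t / 2 * den p t X Y Z * dZ ->
  dL * hor1 p t X Y Z + dhor1 p t X Y Z dX dY dZ - 3 / 4 * hor1 p t X Y Z * q = 0 ->
  dL * hor2 p t X Y Z + dhor2 p t X Y Z dX dY dZ - 3 / 4 * hor2 p t X Y Z * q = 0 ->
  dL * ver p t X Y Z + dver p t X Y Z dX dY dZ - ver p t X Y Z * q = 0 ->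
  [/\ dX = 0, dY = 0 & dZ = 0].
Proof.
move=> p1 t1 pt S T Hq HL E1 E2 E3.
have D0 := den_gt0 p t S.
have := rsq_ge0 X Y; rewrite le_eqVlt => /orP[/eqP/esym s0|s0].
  have [X0 Y0 ZZ dZ0] := pole_tangent S T s0.
  have q0 : q = 0.
    apply: (mulfI (lt0r_neq0 D0)); rewrite Hq mulr0.
    by rewrite /dden /dhsq /drsq s0 X0 Y0 dZ0; ring.
  have dL0 : dL = 0.
    apply: (mulfI (lt0r_neq0 D0)); rewrite HL mulr0 q0.
    by rewrite /dhgt /hgt /drsq s0 X0 Y0 dZ0; ring.
  have Z0 : Z != 0 by apply/eqP => Z0; move/eqP: ZZ; rewrite Z0 mul0r eq_sym oner_eq0.
  move: E1 E2; rewrite q0 dL0 /dhor1 /dhor2 /drsq s0 X0 Y0 dZ0 => E1 E2.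
  split => //; apply: (mulfI Z0); rewrite mulr0; first by rewrite -[RHS]E2; field.
  by rewrite -[LHS]opprK -[RHS]oppr0 -[in RHS]E1; field.
(* The ascribed identity is the differential of [hor_sq]. *)
have [dL0 sq_ F1 F2] := polar_elimination s0 (hsq_ge0 p t X Y Z) (hor_sq p t X Y Z)
  (ltac:(rewrite /hor1 /hor2 /dhor1 /dhor2 /dhsq /hsq /drsq /rsq; ring) :
   2 * (hor1 p t X Y Z * dhor1 p t X Y Z dX dY dZ + hor2 p t X Y Z * dhor2 p t X Y Z dX dY dZ)
     = drsq X Y dX dY * hsq p t X Y Z + rsq X Y * dhsq p t X Y Z dX dY dZ) Hq E1 E2 E3.
apply: (core_rank_off_poles p1 t1 pt S T s0 _ F1 F2 (D := den p t X Y Z)).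
  rewrite D0 /=; have := hsq_le S p1 t1; rewrite /den.
  have : rsq X Y <= 1 by rewrite /rsq -[leRHS]S lerDl -expr2 sqr_ge0.
  nra.
move: HL; rewrite dL0 mulr0 => HL.
have -> : 2 * hgt p t X Y Z * drsq X Y dX dY = hgt p t X Y Z * (rsq X Y * q) by rewrite sq_; ring.
have -> : dhgt p t X Y Z dX dY dZ = hgt p t X Y Z * q + t / 2 * den p t X Y Z * dZ by lra.
ring.
Qed.

(* For p = 0 everything is a function of Z. If dZ <> 0, the vertical component
   varies strictly where Z <= 0 and the squared distance to the axis where Z > 0. *)
Lemma outer_rank t X Y Z dX dY dZ q dL a e l :
  1 / 2 <= t -> 0 <= a -> 0 <= e -> 0 <= l -> (0 < a /\ 0 < e) \/ 0 < l ->
  X * X + Y * Y + Z * Z = 1 -> X * dX + Y * dY + Z * dZ = 0 ->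
  den 0 t X Y Z * q = dden 0 t X Y Z dX dY dZ -> dL = - (t / 2 * dZ) ->
  a * (dL * hor1 0 t X Y Z + dhor1 0 t X Y Z dX dY dZ - 3 / 4 * hor1 0 t X Y Z * q) + l * dX = 0 ->
  a * (dL * hor2 0 t X Y Z + dhor2 0 t X Y Z dX dY dZ - 3 / 4 * hor2 0 t X Y Z * q) + l * dY = 0 ->
  e * (dL * ver 0 t X Y Z + dver 0 t X Y Z dX dY dZ - ver 0 t X Y Z * q) + l * dZ = 0 ->
  [/\ dX = 0, dY = 0 & dZ = 0].
Proof.
move=> t1 a0 e0 l0 ael S T Hq HL E1 E2 E3.
have D0 := den_gt0 0 t S.
have DN := lt0r_neq0 D0.
have := rsq_ge0 X Y; rewrite le_eqVlt => /orP[/eqP/esym s0|s0].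
  have [X0 Y0 ZZ dZ0] := pole_tangent S T s0.
  have q0 : q = 0.
    apply: (mulfI (lt0r_neq0 D0)); rewrite Hq mulr0.
    by rewrite /dden /dhsq /drsq s0 X0 Y0 dZ0; ring.
  have al : a * a + l * l != 0.
    rewrite gt_eqF//; case: ael => [[a1 _]|l1].
      by rewrite ltr_wpDr ?mulr_gt0// mulr_ge0.
    by rewrite ltr_wpDl ?mulr_gt0// mulr_ge0.
  move: E1 E2; rewrite q0 HL /dhor1 /dhor2 /drsq s0 X0 Y0 dZ0 => E1 E2.
  (* At a pole the horizontal equations say (l + i a Z)(dX + i dY) = 0, and |l + i a Z|^2 = l^2 +
     a^2 because Z^2 = 1. *)
  have E1' : l * dX - a * Z * dY = 0 by rewrite -[RHS]E1; field.
  have E2' : l * dY + a * Z * dX = 0 by rewrite -[RHS]E2; field.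
  split => //; apply: (mulfI al); rewrite mulr0.
    transitivity (l * (l * dX - a * Z * dY) + a * Z * (l * dY + a * Z * dX)).
      by rewrite -[in LHS](mulr1 (a * a)) -ZZ; ring.
    by rewrite E1' E2' !mulr0 addr0.
  transitivity (l * (l * dY + a * Z * dX) - a * Z * (l * dX - a * Z * dY)).
    by rewrite -[in LHS](mulr1 (a * a)) -ZZ; ring.
  by rewrite E1' E2' !mulr0 subr0.
have [u [v [dXE dYE dZE]]] := tangent_frame S T s0.
have ZZE : Z * Z = 1 - rsq X Y by rewrite /rsq; lra.
have qE : den 0 t X Y Z * q = 2 * Z * rsq X Y * v * (1 - (2 * (t * t) + 1 / 4) * rsq X Y).
  by rewrite Hq dXE dYE dZE /dden /dhsq /drsq /rsq; field.
have hsq0 : hsq 0 t X Y Z = Z * Z + t * t * (rsq X Y * rsq X Y) by rewrite /hsq; ring.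
have denE : den 0 t X Y Z = Z * Z + (t * t + 1 / 8) * (rsq X Y * rsq X Y).
  by rewrite /den hsq0; field.
have tt : 1 / 4 <= t * t by nra.
have ss0 : 0 < rsq X Y * rsq X Y by exact: mulr_gt0.
have B0 : 0 < hsq 0 t X Y Z by rewrite hsq0; nra.
have drsqE : drsq X Y dX dY = - (2 * Z * rsq X Y * v).
  by rewrite /drsq dXE dYE /rsq; ring.
have dhsqE : dhsq 0 t X Y Z dX dY dZ = 2 * Z * rsq X Y * v * (1 - 2 * (t * t) * rsq X Y).
  by rewrite /dhsq drsqE dZE; ring.
have sE : rsq X Y = 1 - Z * Z by lra.
set W1 := hor1 0 t X Y Z in E1 *; set W2 := hor2 0 t X Y Z in E2 *.
set dW1 := dhor1 0 t X Y Z dX dY dZ in E1 *; set dW2 := dhor2 0 t X Y Z dX dY dZ in E2 *.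
have WW : W1 * W1 + W2 * W2 = rsq X Y * hsq 0 t X Y Z by rewrite hor_sq.
have XW : X * W1 + Y * W2 = t * (rsq X Y * rsq X Y) by rewrite /W1 /W2 /hor1 /hor2 /rsq; ring.
have v0 : v = 0.
  have sN := lt0r_neq0 s0.
  have [Z0|Z0] := lerP Z 0.
    (* This is the vertical equation times [den]. Its cofactor is positive for Z <= 0: [ver] < 0
       because t^2 >= 1/4, and the remaining terms are nonnegative. *)
    have /eqP : (rsq X Y * v) * (e * (- (t / 2 * ver 0 t X Y Z * den 0 t X Y Z)
       - rsq X Y / 2 * Z * (1 + Z * Z)) + l * den 0 t X Y Z) = 0.
      transitivity (den 0 t X Y Z * (e * (dL * ver 0 t X Y Z + dver 0 t X Y Z dX dY dZ
         - ver 0 t X Y Z * q) + l * dZ)); last by rewrite E3 mulr0.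
      have -> : den 0 t X Y Z * (e * (dL * ver 0 t X Y Z + dver 0 t X Y Z dX dY dZ
         - ver 0 t X Y Z * q) + l * dZ) =
        e * (den 0 t X Y Z * (dL * ver 0 t X Y Z + dver 0 t X Y Z dX dY dZ)
         - ver 0 t X Y Z * (den 0 t X Y Z * q)) + l * dZ * den 0 t X Y Z by ring.
      by rewrite qE HL /dver /ver dhsqE drsqE dZE denE hsq0 sE; field.
    rewrite !mulf_eq0 (negPf sN) /= => /orP[/eqP//|]; rewrite gt_eqF//.
    have P : 0 < - (t / 2 * ver 0 t X Y Z * den 0 t X Y Z)
       - rsq X Y / 2 * Z * (1 + Z * Z).
      have : ver 0 t X Y Z < 0 by rewrite /ver hsq0; nra.
      have : 0 <= rsq X Y / 2 * (- Z) * (1 + Z * Z).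
        apply: mulr_ge0; first by apply: mulr_ge0; lra.
        by rewrite addr_ge0// -expr2 sqr_ge0.
      have : 0 < t / 2 by lra.
      move: (t / 2) => c c0 h1 h2.
      have : 0 < c * (- ver 0 t X Y Z) * den 0 t X Y Z by rewrite !mulr_gt0// oppr_gt0.
      lra.
    case: ael => [[_ e1]|l1].
      by rewrite ltr_wpDr ?(mulr_gt0 e1 P)// mulr_ge0// ltW.
    by rewrite ltr_wpDl ?(mulr_gt0 l1 D0)// mulr_ge0// ltW.
  (* The horizontal vector a W + l (X, Y) is paired with its differential, which gives half the
     differential of the squared distance to the axis. After multiplication by [den], the
     coefficients of a^2, a l and l^2 are negative for Z > 0 ([P1], [P2], [P3]). *)
  have /eqP : (rsq X Y * v) * (a * a * (- (t / 2 * rsq X Y * hsq 0 t X Y Z * den 0 t X Y Z)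
       - Z * (1 + Z * Z) * (hsq 0 t X Y Z / 2 - rsq X Y * rsq X Y / 8))
     + a * l * t * (- (t / 2 * (rsq X Y * rsq X Y) * den 0 t X Y Z)
         - Z * rsq X Y * (4 * den 0 t X Y Z
            + 3 / 2 * rsq X Y * (1 - (2 * (t * t) + 1 / 4) * rsq X Y)))
     + l * l * (- (Z * den 0 t X Y Z))) = 0.
    have c3 : W1 * dW1 + W2 * dW2 =
        (drsq X Y dX dY * hsq 0 t X Y Z + rsq X Y * dhsq 0 t X Y Z dX dY dZ) / 2.
      rewrite /W1 /W2 /dW1 /dW2 /hor1 /hor2 /dhor1 /dhor2 /dhsq /hsq /drsq /rsq; by field.
    have c4 : X * dW1 + Y * dW2 + (W1 * dX + W2 * dY) = 2 * t * rsq X Y * drsq X Y dX dY.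
      rewrite /W1 /W2 /dW1 /dW2 /hor1 /hor2 /dhor1 /dhor2 /drsq /rsq; ring.
    have c5 : X * dX + Y * dY = drsq X Y dX dY / 2 by rewrite /drsq; field.
    transitivity (den 0 t X Y Z * ((a * W1 + l * X)
         * (a * (dL * W1 + dW1 - 3 / 4 * W1 * q) + l * dX)
       + (a * W2 + l * Y) * (a * (dL * W2 + dW2 - 3 / 4 * W2 * q) + l * dY))); last first.
      by rewrite E1 E2 !mulr0 addr0 mulr0.
    have -> : den 0 t X Y Z * ((a * W1 + l * X) * (a * (dL * W1 + dW1 - 3 / 4 * W1 * q) + l * dX)
       + (a * W2 + l * Y) * (a * (dL * W2 + dW2 - 3 / 4 * W2 * q) + l * dY)) =
     a * a * (den 0 t X Y Z * (dL * (W1 * W1 + W2 * W2) + (W1 * dW1 + W2 * dW2))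
       - 3 / 4 * (W1 * W1 + W2 * W2) * (den 0 t X Y Z * q))
     + a * l * (den 0 t X Y Z * (dL * (X * W1 + Y * W2) + (X * dW1 + Y * dW2 + (W1 * dX + W2 * dY)))
       - 3 / 4 * (X * W1 + Y * W2) * (den 0 t X Y Z * q))
     + l * l * den 0 t X Y Z * (X * dX + Y * dY) by ring.
    rewrite WW XW c3 c4 c5 qE HL dhsqE drsqE dZE denE hsq0 sE; by field.
  rewrite !mulf_eq0 (negPf sN) /= => /orP[/eqP//|]; rewrite lt_eqF//.
  have P1 : - (t / 2 * rsq X Y * hsq 0 t X Y Z * den 0 t X Y Z)
       - Z * (1 + Z * Z) * (hsq 0 t X Y Z / 2 - rsq X Y * rsq X Y / 8) < 0.
    have h1 : 0 < hsq 0 t X Y Z / 2 - rsq X Y * rsq X Y / 8 by rewrite hsq0; nra.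
    have h2 : 0 < Z * (1 + Z * Z) by rewrite mulr_gt0//; nra.
    have h3 : 0 < t / 2 by lra.
    have := mulr_gt0 h2 h1; have := mulr_gt0 (mulr_gt0 (mulr_gt0 h3 s0) B0) D0; lra.
  have P2 : t * (- (t / 2 * (rsq X Y * rsq X Y) * den 0 t X Y Z)
         - Z * rsq X Y * (4 * den 0 t X Y Z
            + 3 / 2 * rsq X Y * (1 - (2 * (t * t) + 1 / 4) * rsq X Y))) < 0.
    have h1 : 0 < 4 * den 0 t X Y Z + 3 / 2 * rsq X Y * (1 - (2 * (t * t) + 1 / 4) * rsq X Y).
      rewrite denE; have := mulr_gt0 Z0 Z0; nra.
    have h3 : 0 < t / 2 by lra.
    have := mulr_gt0 (mulr_gt0 Z0 s0) h1; have := mulr_gt0 (mulr_gt0 h3 ss0) D0.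
    have : 0 < t by lra.
    nra.
  have P3 := mulr_gt0 Z0 D0.
  rewrite -(mulrA (a * l)).
  have aa : 0 <= a * a by rewrite mulr_ge0.
  have al : 0 <= a * l by rewrite mulr_ge0.
  have lt : 0 <= l * l by rewrite mulr_ge0.
  have [a1|l1] : 0 < a * a \/ 0 < l * l.
    by case: ael => [[a1 _]|l1]; [left|right]; rewrite mulr_gt0.
  - by nra.
  - by nra.
have dZ0 : dZ = 0 by rewrite dZE v0 mulr0.
have ds0 : drsq X Y dX dY = 0 by rewrite drsqE v0 mulr0 oppr0.
have q0 : q = 0 by apply: (mulfI DN); rewrite qE v0 !(mulr0, mul0r).
have dX0 : dX = - Y * u by rewrite dXE v0 mulr0 subr0.
have dY0 : dY = X * u by rewrite dYE v0 mulr0 subr0.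
(* With v = 0 only the rotation about the axis is left. It moves the image unless a W + l (X, Y) =
   0, which is excluded by its positive product with (X, Y). *)
have F1 : u * (a * W2 + l * Y) = 0.
  rewrite -[RHS]oppr0 -[in RHS]E1 HL q0 dZ0 dX0 /dW1 /W2 /hor2 /dhor1 ds0 dZ0 dX0 dY0.
  by rewrite /W1; ring.
have F2 : u * (a * W1 + l * X) = 0.
  rewrite -[RHS]E2 HL q0 dZ0 dY0 /dW2 /W1 /hor1 /dhor2 ds0 dZ0 dX0 dY0.
  by rewrite /W2; ring.
suff u0 : u = 0 by rewrite dX0 dY0 dZ0 u0 !mulr0.
have /eqP : u * (a * (t * (rsq X Y * rsq X Y)) + l * rsq X Y) = 0.
  transitivity (X * (u * (a * W1 + l * X)) + Y * (u * (a * W2 + l * Y))).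
    by rewrite -XW /rsq; ring.
  by rewrite F1 F2 !mulr0 addr0.
rewrite mulf_eq0 => /orP[/eqP//|]; rewrite gt_eqF//.
have tss : 0 < t * (rsq X Y * rsq X Y) by rewrite mulr_gt0//; lra.
case: ael => [[a1 _]|l1].
  by rewrite ltr_wpDr ?(mulr_gt0 a1 tss)// mulr_ge0// ltW.
by rewrite ltr_wpDl ?(mulr_gt0 l1 s0)// mulr_ge0// ltW.
Qed.
End Algebra.

(** * Injectivity on tangent planes in both stages *)

Section Rank.
Context {R : realType}.
Implicit Types (p t c l X Y Z dX dY dZ : R).

(* The two stages of the homotopy: the eversion proper, and the linear homotopy
   to plus or minus the inclusion. *)
Definition regular p t c l :=
  [/\ -1 <= p <= 1, -1 <= t <= 1, p != 0 \/ t != 0, c = 1 & l = 0] \/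
  [/\ p = 0, 1 / 2 <= `|t|, 0 <= c, 0 <= l * t & 0 < c \/ l != 0].

Lemma evert_rank p t c l X Y Z dX dY dZ q dL r g :
  regular p t c l -> 0 < r -> 0 < g ->
  X * X + Y * Y + Z * Z = 1 -> X * dX + Y * dY + Z * dZ = 0 ->
  den p t X Y Z * q = dden p t X Y Z dX dY dZ ->
  den p t X Y Z * dL = dhgt p t X Y Z dX dY dZ - hgt p t X Y Z * q
    - t / 2 * den p t X Y Z * dZ ->
  c * (r * g * (dL * hor1 p t X Y Z + dhor1 p t X Y Z dX dY dZ
    - 3 / 4 * hor1 p t X Y Z * q)) + l * dX = 0 ->
  c * (r * g * (dL * hor2 p t X Y Z + dhor2 p t X Y Z dX dY dZ
    - 3 / 4 * hor2 p t X Y Z * q)) + l * dY = 0 ->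
  c * (r / den p t X Y Z * (dL * ver p t X Y Z + dver p t X Y Z dX dY dZ
    - ver p t X Y Z * q)) + l * dZ = 0 ->
  [/\ dX = 0, dY = 0 & dZ = 0].
Proof.
move=> reg r0 g0 S T Hq HL E1 E2 E3.
have D0 := den_gt0 p t S.
have rg0 := mulr_gt0 r0 g0; have rD0 : 0 < r / den p t X Y Z by rewrite divr_gt0.
case: reg => [[p1 t1 pt c1 l0]|[p0 t1 c0 lt cl]].
  move: E1 E2 E3; rewrite c1 l0 !mul1r !mul0r !addr0 => /eqP E1 /eqP E2 /eqP E3.
  move: E1 E2 E3; rewrite !mulf_eq0 (gt_eqF r0) (gt_eqF g0) invr_eq0 (gt_eqF D0) /=.
  by move=> /eqP E1 /eqP E2 /eqP E3; exact: (core_rank p1 t1 pt S T Hq HL E1 E2 E3).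
have dLE : dL = - (t / 2 * dZ).
  apply: (mulfI (lt0r_neq0 D0)); rewrite HL /dhgt /hgt p0; ring.
move: E1 E2 E3 Hq D0 rD0; rewrite p0 !(mulrA c (r * g)) (mulrA c (r / _)) {HL}.
move=> E1 E2 E3 Hq D0 rD0.
have cl' : (0 < c * (r * g) /\ 0 < c * (r / den 0 t X Y Z)) \/ l != 0.
  by case: cl => [c1|]; [left; split; exact: mulr_gt0|right].
have [t0|t0] := lerP 0 t.
  rewrite (ger0_norm t0) in t1.
  have l0 : 0 <= l by rewrite -(pmulr_lge0 _ (_ : 0 < t))//; lra.
  apply: (outer_rank t1 _ _ l0 _ S T Hq dLE E1 E2 E3).
  - by rewrite mulr_ge0// ltW.
  - by rewrite mulr_ge0// ltW.
  - by case: cl' => [|lN]; [left|right; rewrite lt_def lN].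
rewrite (ltr0_norm t0) in t1.
have l0 : 0 <= - l by rewrite -(pmulr_lge0 _ (_ : 0 < - t)) ?mulrNN//; lra.
(* For p = 0 the map is unchanged when t, X, Y and Z all change sign, so t < 0 reduces to t > 0 with
   l replaced by -l. *)
have [] := @outer_rank _ (- t) (- X) (- Y) (- Z) (- dX) (- dY) (- dZ) q dL (c * (r * g))
    (c * (r / den 0 t X Y Z)) (- l) t1 _ _ l0.
- by rewrite mulr_ge0// ltW.
- by rewrite mulr_ge0// ltW.
- by case: cl' => [|lN]; [left|right; rewrite lt_def oppr_eq0 lN].
- by rewrite !mulrNN.
- by rewrite !mulrNN.
- move: Hq; rewrite /den /dden /hsq /dhsq /drsq /rsq => Hq.
  by apply: etrans (etrans _ Hq) _; [ring|ring].
- by rewrite dLE; field.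
- rewrite mulrNN -[RHS]E1 /hor1 /dhor1 /drsq /rsq; ring.
- rewrite mulrNN -[RHS]E2 /hor2 /dhor2 /drsq /rsq; ring.
- rewrite mulrNN -[RHS]E3 /ver /dver /hsq /dhsq /drsq /rsq; ring.
by move=> /eqP + /eqP + /eqP; rewrite !oppr_eq0 => /eqP -> /eqP -> /eqP ->.
Qed.
End Rank.

(** * Differentials *)

Section IsDD.
Context {R : realType} {V : normedModType R}.
Implicit Types (f g : V -> R) (x v : V).

(** Bundling differentiability with the value in one direction lets the rules below compute the
    differential of a compound expression by following its syntax. *)
Definition is_dd (W : normedModType R) (f : V -> W) (x v : V) (df : W) :=
  differentiable f x /\ 'd f x v = df.

Lemma is_dd_eq f x v df df' : is_dd f x v df -> df = df' -> is_dd f x v df'.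
Proof. by move=> h <-. Qed.

Lemma is_dd_cst (c : R) x v : is_dd (fun=> c) x v 0.
Proof. by split; [exact: differentiable_cst|rewrite (_ : (fun=> c) = cst c)// diff_cst]. Qed.

Lemma is_ddD (W : normedModType R) (f g : V -> W) x v df dg :
  is_dd f x v df -> is_dd g x v dg ->
  is_dd (fun y => f y + g y) x v (df + dg).
Proof.
move=> [cf <-] [cg <-]; split; first exact: differentiableD.
by rewrite (_ : (fun y => f y + g y) = f + g)// diffD.
Qed.

Lemma is_ddM f g x v df dg : is_dd f x v df -> is_dd g x v dg ->
  is_dd (fun y => f y * g y) x v (df * g x + f x * dg).
Proof.
move=> [cf <-] [cg <-]; split; first exact: differentiableM.
transitivity (f x * 'd g x v + g x * 'd f x v); last by rewrite addrC (mulrC (g x)).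
by rewrite (_ : (fun y => f y * g y) = f * g)// diffM.
Qed.

Lemma is_ddN f x v df : is_dd f x v df -> is_dd (fun y => - f y) x v (- df).
Proof.
move=> [cf <-]; split; first exact: differentiableN.
by rewrite (_ : (fun y => - f y) = - f)// diffN.
Qed.

Lemma is_ddZl (W : normedModType R) f (w : W) x v df :
  is_dd f x v df -> is_dd (fun y => f y *: w) x v (df *: w).
Proof. by move=> [cf <-]; split; [exact: differentiableZl|rewrite diffZl]. Qed.

Lemma is_dd_comp f (g : R -> R) x v df dg : is_dd f x v df -> is_derive (f x) 1 g dg ->
  is_dd (fun y => g (f y)) x v (df * dg).
Proof.
move=> [cf <-] hg; have dg' : differentiable g (f x) by apply/derivable1_diffP; case: hg.
split; first exact: differentiable_comp.
rewrite (_ : (fun y => g (f y)) = g \o f)// diff_comp//= deriv1E; last exact/derivable1_diffP.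
by rewrite derive1E derive_val.
Qed.

Lemma is_dd_expR f x v df : is_dd f x v df ->
  is_dd (fun y => expR (f y)) x v (expR (f x) * df).
Proof. by move=> h; rewrite mulrC; exact: is_dd_comp h (is_derive_expR _). Qed.

Lemma is_dd_powR f a x v df : 0 < f x -> is_dd f x v df ->
  is_dd (fun y => f y `^ a) x v (f x `^ a * (a * (df / f x))).
Proof.
move=> f0 h; have := is_dd_comp h (is_derive1_powR a f0).
move/is_dd_eq; apply.
have -> : f x `^ (a - 1) = f x `^ a / f x.
  by rewrite powRB ?(gt_eqF f0) ?implybT// powRr1// ltW.
by ring.
Qed.

End IsDD.

(** * The explicit map, its smoothness and its differential *)

Section SphereMap.
Context {R : realType}.
Implicit Types (p t X Y Z : R).

(* The added square vanishes to first order along the sphere and makes the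
   denominator positive on the whole space. *)
Definition denext p t X Y Z : R :=
  den p t X Y Z + (1 - (X * X + Y * Y + Z * Z)) * (1 - (X * X + Y * Y + Z * Z)).
(** The powers of [rsq] cancel in hgt / den, hor / den^(3/4) and ver / den, so the poles are not
    singular. Inverses are written as powers -1 so that [smooth_powR] covers them. *)
Definition lnrad p t X Y Z : R := hgt p t X Y Z * denext p t X Y Z `^ (- 1) - t / 2 * Z.
Definition evert1 p t X Y Z : R :=
  expR (lnrad p t X Y Z) * (hor1 p t X Y Z * denext p t X Y Z `^ (- (3 / 4))).
Definition evert2 p t X Y Z : R :=
  expR (lnrad p t X Y Z) * (hor2 p t X Y Z * denext p t X Y Z `^ (- (3 / 4))).
Definition evert3 p t X Y Z : R :=
  expR (lnrad p t X Y Z) * (ver p t X Y Z * denext p t X Y Z `^ (- 1)).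

(** On the axis the value is Z^2 + (1 - Z^2)^2 > 0; off it, rsq^2 / 8 is already positive. *)
Lemma denext_gt0 p t X Y Z : 0 < denext p t X Y Z.
Proof.
rewrite /denext /den; have := hsq_ge0 p t X Y Z.
have := rsq_ge0 X Y; rewrite le_eqVlt => /orP[/eqP/esym s0 _|s0 B0].
  have [X0 Y0] := rsq_eq0 s0; rewrite s0 /hsq s0 X0 Y0.
  by nra.
have s2 := mulr_gt0 s0 s0.
have := sqr_ge0 (1 - (X * X + Y * Y + Z * Z)); rewrite expr2; lra.
Qed.

Section Smooth.
Context {V : normedModType R}.
Variables p t X Y Z : V -> R.
Hypotheses (sp : smooth_on setT p) (st : smooth_on setT t) (sX : smooth_on setT X)
  (sY : smooth_on setT Y) (sZ : smooth_on setT Z).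

Ltac smooth := repeat match goal with
  | |- smooth_on _ (fun _ => ?c) => exact: smooth_cst
  | H : ?P |- ?P => exact: H
  | |- smooth_on _ (fun x => - @?f x) => apply: (@smoothN _ _ f)
  | |- smooth_on _ (fun x => @?f x + @?g x) => apply: (@smoothD _ _ _ f g)
  | |- smooth_on _ (fun x => @?f x * @?g x) => apply: (@smoothM _ _ f g)
  | |- smooth_on _ (fun x => expR (@?f x)) => apply: (@smooth_expR _ _ f)
  | |- smooth_on _ (fun x => @?f x `^ ?a) => apply: (@smooth_powR _ _ a f) => [x|];
      first exact: denext_gt0
  end.

Let sdenext : smooth_on setT (fun x => denext (p x) (t x) (X x) (Y x) (Z x)).
Proof. rewrite /denext /den /hsq /rsq; smooth. Qed.

Lemma smooth_evert1 : smooth_on setT (fun x => evert1 (p x) (t x) (X x) (Y x) (Z x)).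
Proof.
have := sdenext; rewrite /evert1 /lnrad /hgt /hor1 /rsq => h; smooth.
Qed.

Lemma smooth_evert2 : smooth_on setT (fun x => evert2 (p x) (t x) (X x) (Y x) (Z x)).
Proof.
have := sdenext; rewrite /evert2 /lnrad /hgt /hor2 /rsq => h; smooth.
Qed.

Lemma smooth_evert3 : smooth_on setT (fun x => evert3 (p x) (t x) (X x) (Y x) (Z x)).
Proof.
have := sdenext; rewrite /evert3 /lnrad /hgt /ver /hsq /rsq => h; smooth.
Qed.
End Smooth.

Section Differential.
Context {V : normedModType R}.
Variables (X Y Z : V -> R) (x v : V) (dX dY dZ : R) (p t : R).
Hypotheses (hX : is_dd X x v dX) (hY : is_dd Y x v dY) (hZ : is_dd Z x v dZ).

Ltac dd := repeat match goal with
  | |- is_dd (fun _ => ?c) _ _ _ => exact: is_dd_cst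
  | H : is_dd ?f ?x ?v _ |- is_dd ?f ?x ?v _ => exact: H
  | H : is_dd ?f ?x ?v _ |- is_dd (fun y => ?f y) ?x ?v _ => exact: H
  | |- is_dd (fun y => - @?f y) _ _ _ => apply: (@is_ddN _ _ f)
  | |- is_dd (fun y => @?f y + @?g y) _ _ _ => apply: (@is_ddD _ _ _ f g)
  | |- is_dd (fun y => @?f y * @?g y) _ _ _ => apply: (@is_ddM _ _ f g)
  end.

Lemma is_dd_rsq : is_dd (fun y => rsq (X y) (Y y)) x v (drsq (X x) (Y x) dX dY).
Proof. by rewrite /rsq; apply: is_dd_eq; [dd|rewrite /drsq; ring]. Qed.

Lemma is_dd_hor1 : is_dd (fun y => hor1 p t (X y) (Y y) (Z y)) x v
  (dhor1 p t (X x) (Y x) (Z x) dX dY dZ).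
Proof.
have hs := is_dd_rsq.
by rewrite /hor1; apply: is_dd_eq; [dd|rewrite /dhor1; ring].
Qed.

Lemma is_dd_hor2 : is_dd (fun y => hor2 p t (X y) (Y y) (Z y)) x v
  (dhor2 p t (X x) (Y x) (Z x) dX dY dZ).
Proof.
have hs := is_dd_rsq.
by rewrite /hor2; apply: is_dd_eq; [dd|rewrite /dhor2; ring].
Qed.

Lemma is_dd_hsq : is_dd (fun y => hsq p t (X y) (Y y) (Z y)) x v
  (dhsq p t (X x) (Y x) (Z x) dX dY dZ).
Proof.
have hs := is_dd_rsq.
by rewrite /hsq; apply: is_dd_eq; [dd|rewrite /dhsq; ring].
Qed.

Lemma is_dd_hgt : is_dd (fun y => hgt p t (X y) (Y y) (Z y)) x v
  (dhgt p t (X x) (Y x) (Z x) dX dY dZ).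
Proof.
have hs := is_dd_rsq.
by rewrite /hgt; apply: is_dd_eq; [dd|rewrite /dhgt; ring].
Qed.

Lemma is_dd_ver : is_dd (fun y => ver p t (X y) (Y y) (Z y)) x v
  (dver p t (X x) (Y x) (Z x) dX dY dZ).
Proof.
have hs := is_dd_rsq; have hh := is_dd_hsq.
by rewrite /ver; apply: is_dd_eq; [dd|rewrite /dver; field].
Qed.

Hypothesis S : X x * X x + Y x * Y x + Z x * Z x = 1.

Let D := den p t (X x) (Y x) (Z x).
Let q := dden p t (X x) (Y x) (Z x) dX dY dZ / D.
Let dL := (dhgt p t (X x) (Y x) (Z x) dX dY dZ - hgt p t (X x) (Y x) (Z x) * q) / D - t / 2 * dZ.

Lemma denext_sphere : denext p t (X x) (Y x) (Z x) = D.
Proof. by rewrite /denext S subrr mulr0 addr0. Qed.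

Lemma is_dd_denext : is_dd (fun y => denext p t (X y) (Y y) (Z y)) x v
  (dden p t (X x) (Y x) (Z x) dX dY dZ).
Proof.
have hs := is_dd_rsq; have hh := is_dd_hsq.
rewrite /denext /den; apply: is_dd_eq; [dd|].
by rewrite /= S subrr !(mulr0, mul0r) /dden; field.
Qed.

Lemma is_dd_denext_powR a : is_dd (fun y => denext p t (X y) (Y y) (Z y) `^ a) x v
  (D `^ a * (a * q)).
Proof.
have := @is_dd_powR _ _ (fun y => denext p t (X y) (Y y) (Z y)) a _ _ _
  (denext_gt0 _ _ _ _ _) is_dd_denext.
by rewrite denext_sphere.
Qed.

Let D0 : 0 < D. Proof. exact: den_gt0. Qed.
Let Dinv : D `^ (- 1) = D^-1. Proof. by rewrite powR_inv1// ltW. Qed.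

Lemma is_dd_rad : is_dd (fun y => expR (lnrad p t (X y) (Y y) (Z y))) x v
  (expR (lnrad p t (X x) (Y x) (Z x)) * dL).
Proof.
apply: (@is_dd_expR _ _ (fun y => lnrad p t (X y) (Y y) (Z y))).
have h1 := is_dd_hgt; have h2 := is_dd_denext_powR (- 1).
rewrite /lnrad; apply: is_dd_eq; [dd|].
by rewrite /= denext_sphere Dinv /dL; ring.
Qed.

Lemma is_dd_evert1 : is_dd (fun y => evert1 p t (X y) (Y y) (Z y)) x v
  (expR (lnrad p t (X x) (Y x) (Z x)) * D `^ (- (3 / 4)) *
   (dL * hor1 p t (X x) (Y x) (Z x) + dhor1 p t (X x) (Y x) (Z x) dX dY dZ
    - 3 / 4 * hor1 p t (X x) (Y x) (Z x) * q)).
Proof.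
have h1 := is_dd_rad; have h2 := is_dd_denext_powR (- (3 / 4)); have h3 := is_dd_hor1.
by rewrite /evert1; apply: is_dd_eq; [dd|rewrite /= denext_sphere; ring].
Qed.

Lemma is_dd_evert2 : is_dd (fun y => evert2 p t (X y) (Y y) (Z y)) x v
  (expR (lnrad p t (X x) (Y x) (Z x)) * D `^ (- (3 / 4)) *
   (dL * hor2 p t (X x) (Y x) (Z x) + dhor2 p t (X x) (Y x) (Z x) dX dY dZ
    - 3 / 4 * hor2 p t (X x) (Y x) (Z x) * q)).
Proof.
have h1 := is_dd_rad; have h2 := is_dd_denext_powR (- (3 / 4)); have h3 := is_dd_hor2.
by rewrite /evert2; apply: is_dd_eq; [dd|rewrite /= denext_sphere; ring].
Qed.

Lemma is_dd_evert3 : is_dd (fun y => evert3 p t (X y) (Y y) (Z y)) x v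
  (expR (lnrad p t (X x) (Y x) (Z x)) / D *
   (dL * ver p t (X x) (Y x) (Z x) + dver p t (X x) (Y x) (Z x) dX dY dZ
    - ver p t (X x) (Y x) (Z x) * q)).
Proof.
have h1 := is_dd_rad; have h2 := is_dd_denext_powR (- 1); have h3 := is_dd_ver.
by rewrite /evert3; apply: is_dd_eq; [dd|rewrite /= denext_sphere Dinv; ring].
Qed.

End Differential.
End SphereMap.

(** * Coordinates *)

Section Orthonormal.
Context {R : realType} {E : normedVectType R} (dot : {dot E for idfun}).

Lemma dotC (x y : E) : dot x y = dot y x.
Proof. by rewrite hermC expr0 mul1r. Qed.

Lemma mem_orthogonal (x e : E) : (x \in orthov dot <[e]>%VS) = (dot e x == 0).
Proof. by rewrite dotC; exact: mem_orthov1. Qed.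

Lemma exists_unit_vector (U : {vspace E}) :
  (0 < \dim U)%N -> exists2 e, e \in U & dot e e = 1.
Proof.
rewrite lt0n dimv_eq0 -vpick0 => /(@neq0_dnorm_gt0 _ _ _ dot) e0.
exists ((Num.sqrt (dot (vpick U) (vpick U)))^-1 *: vpick U).
  by rewrite memvZ// memv_pick.
rewrite linearZr linearZl_LR/= mulrA -invfM -expr2 sqr_sqrtr ?ltW// mulVf//.
exact: lt0r_neq0.
Qed.

Lemma dim_orthogonal_complement (U : {vspace E}) e : e \in U -> dot e e = 1 ->
  \dim (U :&: orthov dot <[e]>)%VS = (\dim U).-1.
Proof.
move=> eU e1; rewrite -(@eq_dim_orthov1 _ _ _ _ dot)//.
by apply/mem_orthovPn; exists e => //; apply/eqP => e0;
  have /eqP[] := oner_neq0 R; exact: etrans (esym e1) e0.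
Qed.

(** Unit vectors are picked in successive orthogonal complements. After three steps the complement
    is 0, and x minus its expansion lies in it. *)
Lemma orthonormal_basis3 : \dim {:E} = 3%N ->
  exists e1 e2 e3 : E,
    [/\ [/\ dot e1 e1 = 1, dot e2 e2 = 1 & dot e3 e3 = 1],
        [/\ dot e1 e2 = 0, dot e1 e3 = 0 & dot e2 e3 = 0] &
        forall x, x = dot e1 x *: e1 + dot e2 x *: e2 + dot e3 x *: e3].
Proof.
move=> dimE.
have [|e1 e1U n1] := @exists_unit_vector fullv; first by rewrite dimE.
have d1 := dim_orthogonal_complement e1U n1.
set U1 := (_ :&: _)%VS in d1.
have [|e2 e2U n2] := @exists_unit_vector U1; first by rewrite d1 dimE.
have d2 := dim_orthogonal_complement e2U n2.
set U2 := (_ :&: _)%VS in d2.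
have [|e3 e3U n3] := @exists_unit_vector U2; first by rewrite d2 d1 dimE.
have d3 := dim_orthogonal_complement e3U n3.
have d12 : dot e1 e2 = 0.
  by move: e2U; rewrite memv_cap mem_orthogonal => /andP[_ /eqP].
have [d13 d23] : dot e1 e3 = 0 /\ dot e2 e3 = 0.
  by move: e3U; rewrite !memv_cap !mem_orthogonal => /andP[/andP[_ /eqP h1] /eqP h2].
exists e1, e2, e3; split => // x.
apply/eqP; rewrite -subr_eq0 -memv0; move: d3; rewrite d2 d1 dimE => /eqP.
rewrite dimv_eq0 => /eqP <-.
rewrite !memv_cap memvf !mem_orthogonal.
rewrite !linearBr !linearDr !linearZr/= n1 n2 n3 d12 d13 d23 (dotC e2 e1) d12.
rewrite (dotC e3 e1) d13 (dotC e3 e2) d23.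
by rewrite !mulr0 !mulr1 !addr0 !add0r !subrr eqxx.
Qed.

End Orthonormal.

(** * The map in an orthonormal frame of E *)

Section Coordinates.
Context {R : realType} {E : normedVectType R} (dot : {dot E for idfun}) (dotE : induces_norm dot).
Variables e1 e2 e3 : E.
Hypotheses (n1 : dot e1 e1 = 1) (n2 : dot e2 e2 = 1) (n3 : dot e3 e3 = 1)
 (d12 : dot e1 e2 = 0) (d13 : dot e1 e3 = 0) (d23 : dot e2 e3 = 0).
Hypothesis eE : forall x, x = dot e1 x *: e1 + dot e2 x *: e2 + dot e3 x *: e3.

Lemma dot_coord x y : dot x y = dot e1 x * dot e1 y + dot e2 x * dot e2 y + dot e3 x * dot e3 y.
Proof.
by rewrite {1}(eE x) !linearDl/= !linearZl_LR/=.
Qed.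
(** This is Cauchy-Schwarz, from the nonnegative square of x - <e,x> e. It links the form to the
    topology of E and makes coordinates continuous. *)
Lemma normr_dot_le (e x : E) : dot e e = 1 -> `|dot e x| <= `|x|.
Proof.
move=> ee; rewrite dotE -sqrtr_sqr ler_wsqrtr//.
have : 0 <= dot (x - dot e x *: e) (x - dot e x *: e).
  have [->|/(@neq0_dnorm_gt0 _ _ _ dot)/ltW//] := eqVneq (x - dot e x *: e) 0.
  by rewrite linear0r.
rewrite !linearBr/= !linearBl/= !linearZr/= !linearZl_LR/= ee (dotC _ x e) expr2; lra.
Qed.

Lemma dot_continuous (e : E) : dot e e = 1 -> continuous (dot e : E -> R).
Proof.
move=> ee; apply: (@bounded_linear_continuous _ E R (dot e)).
apply/linear_boundedP; near=> M => x.
by rewrite (le_trans (normr_dot_le x ee))// ler_peMl//; near: M; exact: nbhs_pinfty_ge.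
Unshelve. all: by end_near. Qed.
Lemma smooth_dot (e : E) : dot e e = 1 -> smooth_on setT (dot e).
Proof. move=> ee n; apply: (@Cn_on_linear _ _ _ _ (dot e)). exact: dot_continuous. Qed.
Lemma smooth_dot_snd (e : E) : dot e e = 1 -> smooth_on setT (fun p : R * E => dot e p.2).
Proof.
move=> ee n; apply: (@Cn_on_linear _ _ R _ ((dot e) \o snd)).
move=> x; apply: continuous_comp; first exact: cvg_snd.
exact: dot_continuous.
Qed.
Lemma smooth_fst : smooth_on setT (fun p : R * E => p.1).
Proof.
move=> n; apply: (@Cn_on_linear _ _ R _ (@fst R^o E)).
move=> x; exact: cvg_fst.
Qed.
Lemma is_dd_dot (e x v : E) : dot e e = 1 -> is_dd (dot e) x v (dot e v).
Proof.
move=> /dot_continuous ce; split; first exact: linear_differentiable.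
by rewrite diff_lin.
Qed.

(** One family covers both stages: (c, l) = (1, 0) is the eversion proper, and (0, 1) and (0, -1)
    are plus and minus the identity. *)
Definition frame_map p t c l (x : E) : E :=
  (c * evert1 p t (dot e1 x) (dot e2 x) (dot e3 x) + l * dot e1 x) *: e1
  + (c * evert2 p t (dot e1 x) (dot e2 x) (dot e3 x) + l * dot e2 x) *: e2
  + (c * evert3 p t (dot e1 x) (dot e2 x) (dot e3 x) + l * dot e3 x) *: e3.

Lemma frame_eq0 (a b c : R) : a *: e1 + b *: e2 + c *: e3 = 0 -> [/\ a = 0, b = 0 & c = 0].
Proof.
move=> h; have d21 := d12; have d31 := d13; have d32 := d23.
rewrite dotC in d21; rewrite dotC in d31; rewrite dotC in d32.
split; [have := congr1 (dot e1) h|have := congr1 (dot e2) h|have := congr1 (dot e3) h];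
 rewrite linear0r !linearDr/= !linearZr/= ?(n1, n2, n3, d12, d13, d23, d21, d31, d32);
 by rewrite !(mulr0, mulr1, addr0, add0r).
Qed.

(** The coordinates of the differential are the left-hand sides in [evert_rank], with r the
    exponential of [lnrad] and g = den^(-3/4). *)
Lemma frame_map_rank p t c l x v : regular p t c l -> `|x| = 1 -> dot x v = 0 ->
  'd (frame_map p t c l) x v = 0 -> v = 0.
Proof.
move=> reg nx xv.
have S : dot e1 x * dot e1 x + dot e2 x * dot e2 x + dot e3 x * dot e3 x = 1.
  rewrite -(dot_coord) -[LHS]sqr_sqrtr; first by rewrite -dotE nx expr1n.
  by rewrite (dot_coord) -!expr2 !addr_ge0// sqr_ge0.
have T : dot e1 x * dot e1 v + dot e2 x * dot e2 v + dot e3 x * dot e3 v = 0.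
  by rewrite -(dot_coord).
have h1 := is_dd_dot x v n1; have h2 := is_dd_dot x v n2.
have h3 := is_dd_dot x v n3.
have g1 := is_dd_evert1 p t h1 h2 h3 S; have g2 := is_dd_evert2 p t h1 h2 h3 S.
have g3 := is_dd_evert3 p t h1 h2 h3 S.
have D0 := den_gt0 p t S.
have cst a : is_dd (fun=> a) x v 0 := is_dd_cst a x v.
have [_ ->] := is_ddD (is_ddD
  (is_ddZl e1 (is_ddD (is_ddM (cst c) g1) (is_ddM (cst l) h1)))
  (is_ddZl e2 (is_ddD (is_ddM (cst c) g2) (is_ddM (cst l) h2))))
  (is_ddZl e3 (is_ddD (is_ddM (cst c) g3) (is_ddM (cst l) h3))).
rewrite !mul0r !add0r => /frame_eq0[E1 E2 E3].
have [||v1 v2 v3] := evert_rank reg (expR_gt0 _) (powR_gt0 _ D0) S T _ _ E1 E2 E3.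
- by rewrite mulrC divfK// gt_eqF.
- by rewrite mulrBr mulrC divfK ?gt_eqF//; ring.
by rewrite (eE v) v1 v2 v3 !scale0r !addr0.
Qed.

Lemma frame_map_smooth (V : normedModType R) (p t c l : V -> R) (f : V -> E) :
  smooth_on setT p -> smooth_on setT t -> smooth_on setT c -> smooth_on setT l ->
  smooth_on setT (fun x => dot e1 (f x)) -> smooth_on setT (fun x => dot e2 (f x)) ->
  smooth_on setT (fun x => dot e3 (f x)) ->
  smooth_on setT (fun x => frame_map (p x) (t x) (c x) (l x) (f x)).
Proof.
move=> sp st sc sl s1 s2 s3.
have h1 := smooth_evert1 sp st s1 s2 s3; have h2 := smooth_evert2 sp st s1 s2 s3.
have h3 := smooth_evert3 sp st s1 s2 s3.
by apply: smoothD; [apply: smoothD|]; apply: smoothZl; apply: smoothD; apply: smoothM.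
Qed.
End Coordinates.

(** * The time schedule and the homotopy *)

Unset Implicit Arguments.

Theorem theorem5p1 (R : realType) (E : normedVectType R)
    (dot : {dot E for idfun}) (dimE : \dim {:E} = 3%N)
    (dotE : induces_norm dot) :
  exists f : R -> E -> E,
    [/\ smooth_on setT (fun p : R * E => f p.1 p.2),
        (forall x, unit_sphere E x -> f 0 x = x),
        (forall x, unit_sphere E x -> f 1 x = - x) &
        (forall t : R, 0 <= t <= 1 -> sphere_immersion dot (f t))].
Proof.
have [e1 [e2 [e3 [[n1 n2 n3] [d12 d13 d23] eE]]]] := orthonormal_basis3 dot dimE.
have b0 : 0 < cutoff (1 / 4 : R) by apply: cutoff_gt0; lra.
have bN := lt0r_neq0 b0.
(* The parameter 1 - 2 t has absolute value at least 1/2 exactly for t <= 1/4 or t >= 3/4, where p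
   vanishes. Dividing by [cutoff (1 / 4)] makes l1 equal to 1 at time 0 and l2 equal to 1 at time
   1. *)
pose p (t : R) := cutoff (t - 1 / 4) * cutoff (3 / 4 - t).
pose l1 (t : R) := cutoff (1 / 4 - t) * (cutoff (1 / 4))^-1.
pose l2 (t : R) := cutoff (t - 3 / 4) * (cutoff (1 / 4))^-1.
pose f (t : R) := frame_map dot e1 e2 e3 (p t) (1 - 2 * t) (1 - l1 t - l2 t) (l1 t - l2 t).
(* A general source V gives both the joint smoothness on R x E and the smoothness of each f_t on
   E. *)
have fsmooth (V : normedModType R) (g : V -> R) (h : V -> E) : smooth_on setT g ->
    smooth_on setT (fun x => dot e1 (h x)) -> smooth_on setT (fun x => dot e2 (h x)) ->
    smooth_on setT (fun x => dot e3 (h x)) -> smooth_on setT (fun x => f (g x) (h x)).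
  move=> sg s1 s2 s3.
  have sc c : smooth_on setT (fun x : V => c : R) by exact: smooth_cst.
  have sN := smoothN sg.
  have sl1 : smooth_on setT (fun x => l1 (g x)).
    by apply: smoothM => //; apply: smooth_flat; exact: smoothD.
  have sl2 : smooth_on setT (fun x => l2 (g x)).
    by apply: smoothM => //; apply: smooth_flat; exact: smoothD.
  apply: frame_map_smooth => //.
  - by apply: smoothM; apply: smooth_flat; exact: smoothD.
  - by apply: smoothD => //; apply: smoothN; exact: smoothM.
  - by apply: smoothD; [apply: smoothD => //|]; exact: smoothN.
  - by apply: smoothD => //; exact: smoothN.
have l1_ge0 t : 0 <= l1 t by rewrite mulr_ge0 ?cutoff_ge0// invr_ge0 cutoff_ge0.
have l2_ge0 t : 0 <= l2 t by rewrite mulr_ge0 ?cutoff_ge0// invr_ge0 cutoff_ge0.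
have l1_le1 t : 0 <= t -> l1 t <= 1.
  by move=> t0; rewrite ler_pdivrMr// [leRHS]mul1r; apply: cutoff_mono; lra.
have l2_le1 t : t <= 1 -> l2 t <= 1.
  by move=> t0; rewrite ler_pdivrMr// [leRHS]mul1r; apply: cutoff_mono; lra.
have l1_eq0 t : 1 / 4 <= t -> l1 t = 0.
  by move=> t0; rewrite /l1 cutoff_eq0 ?mul0r//; lra.
have l2_eq0 t : t <= 3 / 4 -> l2 t = 0.
  by move=> t0; rewrite /l2 cutoff_eq0 ?mul0r//; lra.
have p_eq0 t : t <= 1 / 4 \/ 3 / 4 <= t -> p t = 0.
  by case=> t0; rewrite /p; [rewrite (@cutoff_eq0 _ (t - _)) ?mul0r//|
    rewrite (@cutoff_eq0 _ (_ - t)) ?mulr0//]; lra.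
have reg t : 0 <= t <= 1 -> regular (p t) (1 - 2 * t) (1 - l1 t - l2 t) (l1 t - l2 t).
  move=> /andP[t0 t1].
  have [ht|ht] := lerP t (1 / 4).
    right; rewrite (l2_eq0 t) ?subr0; last lra.
    have l1t := l1_le1 _ t0; split.
    - by apply: p_eq0; left.
    - by rewrite ger0_norm; lra.
    - by rewrite subr_ge0.
    - by rewrite mulr_ge0//; lra.
    - have [->|] := eqVneq (l1 t) 0; [by left; rewrite subr0|by right].
  have [ht'|ht'] := lerP (3 / 4) t.
    right; rewrite (l1_eq0 t) ?(sub0r, subr0); last lra.
    have l2t := l2_le1 _ t1; split.
    - by apply: p_eq0; right.
    - by rewrite ler0_norm; lra.
    - by rewrite subr_ge0.
    - by rewrite mulNr -mulrN mulr_ge0//; lra.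
    - have [->|] := eqVneq (l2 t) 0; [by left; rewrite subr0|by right; rewrite oppr_eq0].
  left; rewrite (l1_eq0 t) ?(l2_eq0 t) ?subr0; [|lra|lra].
  (* Both cutoffs are positive here, so p is nonzero even at t = 1/2, where 1 - 2 t vanishes. *)
  split => //; last by left; rewrite gt_eqF// mulr_gt0// cutoff_gt0//; lra.
    rewrite (le_trans _ (mulr_ge0 (cutoff_ge0 _) (cutoff_ge0 _)))/=; last lra.
    by rewrite mulr_ile1 ?cutoff_ge0 ?cutoff_le1.
  by apply/andP; split; lra.
have fE t x c : p t = 0 -> 1 - l1 t - l2 t = 0 -> l1 t - l2 t = c -> f t x = c *: x.
  move=> p0 c0 lc; rewrite /f /frame_map c0 lc !mul0r !add0r.
  by rewrite {4}(eE x) !scalerDr !scalerA.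
exists f; split.
- by apply: fsmooth; [exact: smooth_fst|exact: smooth_dot_snd..].
- move=> x _; rewrite (fE _ _ 1) ?scale1r//.
  + by apply: p_eq0; left; lra.
  + by rewrite /l1 subr0 divff// (l2_eq0 0) ?subr0 ?subrr//; lra.
  + by rewrite /l1 subr0 divff// (l2_eq0 0) ?subr0//; lra.
- have l21 : l2 1 = 1.
    by rewrite /l2 (_ : 1 - 3 / 4 = 1 / 4 :> R) ?divff//; field.
  move=> x _; rewrite (fE _ _ (-1)) ?scaleN1r//.
  + by apply: p_eq0; right; lra.
  + by rewrite l21 (l1_eq0 1) ?subr0 ?subrr//; lra.
  + by rewrite l21 (l1_eq0 1) ?sub0r//; lra.
move=> t t01; split.
  exists setT; split => //; first exact: openT.
  by apply: (fsmooth _ (fun=> t) id); [exact: smooth_cst|exact: smooth_dot..].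
move=> x nx a b /set_mem ax /set_mem bx ab; apply/eqP; rewrite -subr_eq0; apply/eqP.
apply: (frame_map_rank dotE n1 n2 n3 d12 d13 d23 eE (reg t t01) nx).
  by rewrite linearBr/= ax bx subrr.
by rewrite linearB/= ab subrr.
Qed.
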